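(* Let $b(\cdot,\cdot)$ be an inner product on $\mathbb{R}^n$ with norm $\|\mathbf v\|_b=\sqrt{b(\mathbf v,\mathbf v)}$, and suppose that for some $b_1,b_2>0$, $b_1\|\mathbf v\|_b\le\sqrt{\mathbf v^T\mathbf A\mathbf v}\le b_2\|\mathbf v\|_b$ for all $\mathbf v\in\mathbb{R}^n$. Let $\{\mathbf u^j\}_{j\in\mathbb{N}}$ be the sequence generated by GMRES, applied with respect to $b(\cdot,\cdot)$ to the preconditioned system $\mathbf{BAu}=\mathbf{Bf}$, starting from an initial vector $\mathbf u^0$. Let $\Lambda=\big(\zeta\,\zeta^{*}\max_{i=1,\dots,M}\lambda_{i,m_i+1}\big)^{1/2}$. If $\Lambda<1$, then after $j$ steps the norm of the residual of the GMRES algorithm can be bounded by $$\|\mathbf{BA}(\mathbf u-\mathbf u^j)\|_b\le\Lambda^j\left(\frac{1+\Lambda}{1-\Lambda}\,\frac{b_2}{b_1}\right)\|\mathbf{BA}(\mathbf u-\mathbf u^0)\|_b .$$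
   Context: Abstract setting (finite-dimensional case). $V_0(\Omega)$ is a finite-dimensional space of functions on $\Omega$, $a(\cdot,\cdot)$ is a symmetric positive definite bilinear form on $V_0(\Omega)$, and $F\in V_0(\Omega)'$. There are function spaces $\{V(D),V_0(D):D\subset\Omega\}$ indexed by subdomains such that: (i) For any subdomain $D\subset\Omega$, $V_0(D)\subset V(D)$; moreover $V(\Omega)=V_0(\Omega)$. (ii) For $D\subset D^*$ there is a linear operator (zero extension) $E_{D,D^*}:V_0(D)\to V_0(D^* )$ with $\|E_{D,D^*}(u)\|_{V_0(D^* )}=\|u\|_{V_0(D)}$ for all $u\in V_0(D)$; in particular $\|u\|_{V_0(D)}=\|E_{D,\Omega}(u)\|_{V_0(\Omega)}$. One identifies $u\in V_0(D)$ with its zero extension $E_{D,D^*}(u)$. (iii) For $D\subset D^*$ there is a (linear) restriction operator $R_{D^*,D}:V(D^* )\to V(D)$ with $R_{D^*,D}(E_{D,D^*}(u))=u$ for $u\in V_0(D)$, $R_{D^*,D}\circ R_{D^{**},D^*}=R_{D^{**},D}$ for $D\subset D^*\subset D^{**}$, and $\|R_{D^*,D}(u)\|_{V(D)}\le\|u\|_{V(D^* )}$ for $u\in V(D^* )$; write $u|_D=R_{D^*,D}(u)$. (iv) For each $D$ there is a bounded symmetric positive semi-definite bilinear form $a_D(\cdot,\cdot)$ on $V(D)$, with $a_\Omega=a$, and for $D\subset D^*$, $a_D(u|_D,v)=a_{D^*}(u,E_{D,D^*}(v))$ for all $u\in V(D^* )$, $v\in V_0(D)$. Set $\|u\|_{a,D}=\sqrt{a_D(u,u)}$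 and $\|u\|_a=\|u\|_{a,\Omega}$. Decomposition. $\{\omega_i\}_{i=1}^M$ are overlapping subdomains of $\Omega$ with $\cup_{i=1}^M\omega_i=\Omega$; $\omega_i^*\supset\omega_i$ are oversampling domains with $\operatorname{dist}(\omega_i,\partial\omega_i^*\setminus\partial\Omega)>0$. $\{\chi_i\}_{i=1}^M$ is an abstract partition of unity: bounded linear operators $\chi_i:V(\omega_i)\to V_0(\omega_i)$ with $u=\sum_{i=1}^M\chi_i(u|_{\omega_i})$ for all $u\in V_0(\Omega)$. The coloring constant $\zeta$ of $\{\omega_i\}_{i=1}^M$ is the smallest positive integer such that $\{\omega_i\}_{i=1}^M$ can be partitioned into $\zeta$ classes for which any two distinct members $\omega_{j_1},\omega_{j_2}$ of the same class satisfy $a(u_1,u_2)=0$ for all $u_1\in V_0(\omega_{j_1})$, $u_2\in V_0(\omega_{j_2})$ (it is typically equal to the maximal number of $\omega_i$'s overlapping at any one point). $\zeta^*$ is the coloring constant, defined in the same way, of the oversampling domains $\{\omega_i^*\}_{i=1}^M$. Coarse space. Let $V_a(\omega_i^* )=\{u\in V(\omega_i^* ):a_{\omega_i^*}(u,v)=0\ \forall v\in V_0(\omega_i^* )\}$ and consider the eigenproblem: find $\lambda_i\in\mathbb{R}\cup\{+\infty\}$ and $\phi_i\in V_a(\omega_i^* )$ such that $$a_{\omega_i}(\chi_i(\phi_i|_{\omega_i}),\chi_i(v|_{\omega_i}))=\lambda_i\,a_{\omega_i^*}(\phi_i,v)\quad\forall v\in V_a(\omega_i^* ).$$ Let $\lambda_{i,j}$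 and $\phi_{i,j}$ denote the $j$-th eigenvalue and eigenfunction, with eigenvalues arranged in decreasing order; the value $+\infty$ is assigned to the kernel of $a_{\omega_i^*}$ on $V_a(\omega_i^* )$, whose elements thus come first. The integers $m_i$ satisfy $m_i\ge l_i$, where $l_i$ is the dimension of the kernel of $a_{\omega_i^*}(\cdot,\cdot)$ on $V_a(\omega_i^* )$. Set $S_{m_i}(\omega_i)=\operatorname{span}\{\phi_{i,1}|_{\omega_i},\dots,\phi_{i,m_i}|_{\omega_i}\}$ and $S_m(\Omega)=\{\sum_{i=1}^M\chi_i(\phi_i):\phi_i\in S_{m_i}(\omega_i)\}$. Matrices. $\widetilde\chi_i:V_0(\omega_i^* )\to V_0(\omega_i^* )$ is given by $\widetilde\chi_i(v)=\chi_i(v|_{\omega_i})$. Given a basis of $V_0(\Omega)$, $n=\dim V_0(\Omega)$, the problem of finding $u\in V_0(\Omega)$ with $a(u,v)=F(v)$ for all $v\in V_0(\Omega)$ is written as the linear system $\mathbf{Au}=\mathbf f$, with $\mathbf A\in\mathbb{R}^{n\times n}$ the matrix of $a$ and $\mathbf f\in\mathbb{R}^n$ the vector of values of $F$ on the basis. $\mathbf R_S^T$, $\widetilde{\mathbf R}_i^T$, $\widetilde{\boldsymbol\chi}_i$ are the matrix representations of the embedding $S_m(\Omega)\to V_0(\Omega)$, the inclusion $V_0(\omega_i^* )\to V_0(\Omega)$, and the operator $\widetilde\chi_i$, respectively; $\widetilde{\mathbf A}_i=\widetilde{\mathbf R}_i\mathbf A\widetilde{\mathbf R}_i^T$, $\mathbf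 A_S=\mathbf R_S\mathbf A\mathbf R_S^T$, $\mathbf I$ is the identity matrix, and $$\mathbf B=\Big(\sum_{i=1}^M\widetilde{\mathbf R}_i^T\widetilde{\boldsymbol\chi}_i\widetilde{\mathbf A}_i^{-1}\widetilde{\mathbf R}_i\Big)+\big(\mathbf R_S^T\mathbf A_S^{-1}\mathbf R_S\big)\Big(\mathbf I-\mathbf A\sum_{i=1}^M\widetilde{\mathbf R}_i^T\widetilde{\boldsymbol\chi}_i\widetilde{\mathbf A}_i^{-1}\widetilde{\mathbf R}_i\Big).$$ GMRES. The $j$-th GMRES iterate $\mathbf u^j$ minimizes $\|\mathbf{BA}(\mathbf u-\mathbf v)\|_b$ over $\mathbf v\in\mathbf u^0+\mathcal K_j$, where $\mathcal K_j=\operatorname{span}\{\mathbf{BA}(\mathbf u-\mathbf u^0),(\mathbf{BA})^2(\mathbf u-\mathbf u^0),\dots,(\mathbf{BA})^j(\mathbf u-\mathbf u^0)\}$.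
   Formalization: Adds an assumption: for pairwise a-orthogonal oversampling domains, the energies of u restricted to them sum to at most ||u||_a^2 (u in V_0(Ω)). It does not follow from (i)-(iv); without it the bound fails, as rescaling a_{ω_i*} on V_a(ω_i* ) makes Λ arbitrarily small while B is unchanged. *)

(* Defs.v *)
From HB Require Import structures.
From mathcomp Require Import all_boot all_order all_algebra.
From mathcomp Require Import all_classical all_reals ereal topology normedtype.

Set Implicit Arguments.
Unset Strict Implicit.
Unset Printing Implicit Defensive.

Import Order.TTheory GRing.Theory Num.Theory passmx.
Import numFieldNormedType.Exports.

Local Open Scope classical_set_scope.
Local Open Scope ring_scope.

Definition boundary (T : topologicalType) (A : set T) : set T :=
  closure A `\` interior A.

(* Equal to +oo when A or B is empty. The norm of 'rV[R]_d is the maximum norm;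
   whether the distance is positive does not depend on the choice of norm. *)
Definition set_dist (R : realType) (d : nat) (A B : set 'rV[R]_d) : \bar R :=
  ereal_inf [set `|p.1 - p.2|%:E | p in A `*` B].

Definition is_norm (R : realType) (W : lmodType R) (nu : W -> R) : Prop :=
  [/\ forall x y, nu (x + y) <= nu x + nu y,
      forall c x, nu (c *: x) = `|c| * nu x
    & forall x, nu x = 0 -> x = 0].

(* The families are indexed by all subsets of 'rV[R]_d, but only their members
   at the admissible subdomains matter: every law is restricted to those. *)
Record local_spaces (R : realType) (d : nat) := LocalSpaces {
  Omega : set 'rV[R]_d;
  subdomain : set (set 'rV[R]_d);
  V : set 'rV[R]_d -> vectType R;
  V0 : forall D, {vspace V D};
  normV : forall D, V D -> R;
  normV0 : forall D, subvs_of (V0 D) -> R;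
  (* ext D Ds is E_{D,Ds}; res Ds D is R_{Ds,D} *)
  ext : forall D Ds, 'Hom(subvs_of (V0 D), subvs_of (V0 Ds));
  res : forall Ds D, 'Hom(V Ds, V D);
  form : forall D, {symmetric V D};

  subdomain_Omega : subdomain Omega;
  subdomain_open : forall D, subdomain D -> open D;
  subdomain_sub : forall D, subdomain D -> D `<=` Omega;
  normV_norm : forall D, subdomain D -> is_norm (@normV D);
  normV0_norm : forall D, subdomain D -> is_norm (@normV0 D);
  V0_Omega : V0 Omega = fullv;
  normV0_Omega : forall u, normV0 u = normV (vsval u : V Omega);
  ext_norm : forall D Ds, subdomain D -> subdomain Ds -> D `<=` Ds ->
    forall u, normV0 (ext D Ds u) = normV0 u;
  res_ext : forall D Ds, subdomain D -> subdomain Ds -> D `<=` Ds ->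
    forall u, res Ds D (vsval (ext D Ds u)) = vsval u;
  res_comp : forall D Ds Dss,
    subdomain D -> subdomain Ds -> subdomain Dss -> D `<=` Ds -> Ds `<=` Dss ->
    forall u, res Ds D (res Dss Ds u) = res Dss D u;
  res_norm : forall D Ds, subdomain D -> subdomain Ds -> D `<=` Ds ->
    forall u, normV (res Ds D u) <= normV u;
  form_bounded : forall D, subdomain D ->
    exists C, forall u v, `|form D u v| <= C * normV u * normV v;
  form_ge0 : forall D, subdomain D -> forall u, 0 <= form D u u;
  form_gt0 : forall u, u != 0 -> 0 < form Omega u u;
  form_res_ext : forall D Ds, subdomain D -> subdomain Ds -> D `<=` Ds ->
    forall u v, form D (res Ds D u) (vsval v) = form Ds u (vsval (ext D Ds v)) }.

Arguments Omega {R d} l.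
Arguments subdomain {R d} l.
Arguments V {R d} l D.
Arguments V0 {R d} l D.
Arguments normV {R d l D} u.
Arguments normV0 {R d l D} u.
Arguments ext {R d} l D Ds.
Arguments res {R d} l Ds D.
Arguments form {R d} l D.

Notation space0 X D := (subvs_of (V0 X D)).

Definition incl (R : realType) (W : vectType R) (U : {vspace W}) :
  'Hom(subvs_of U, W) := linfun vsval.

(* V Omega stands for V_0(Omega), which it equals by V0_Omega. *)
Definition ext_Omega (R : realType) (d : nat) (X : local_spaces R d) D :
    'Hom(space0 X D, V X (Omega X)) :=
  (incl (V0 X (Omega X)) \o ext X D (Omega X))%VF.

Record decomposition (R : realType) (d : nat) (X : local_spaces R d)
    (M : nat) := Decomposition {
  om : 'I_M -> set 'rV[R]_d;
  oms : 'I_M -> set 'rV[R]_d;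
  chi : forall i, 'Hom(V X (om i), space0 X (om i));

  om_subdomain : forall i, subdomain X (om i);
  oms_subdomain : forall i, subdomain X (oms i);
  om_cover : \bigcup_i om i = Omega X;
  om_sub_oms : forall i, om i `<=` oms i;
  om_oms_dist : forall i,
    (0 < set_dist (om i) (boundary (oms i) `\` boundary (Omega X)))%E;
  chi_bounded : forall i, exists C, forall u, normV0 (chi i u) <= C * normV u;
  chi_unity : forall u,
    u = \sum_i ext_Omega X (om i) (chi i (res X (Omega X) (om i) u)) }.

Arguments om {R d X M} _ i.
Arguments oms {R d X M} _ i.
Arguments chi {R d X M} _ i.

Section Method.
Variables (R : realType) (d : nat) (X : local_spaces R d).

Definition a_orthogonal (D1 D2 : set 'rV[R]_d) : Prop :=
  forall (u1 : space0 X D1) (u2 : space0 X D2),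
    form X (Omega X) (ext_Omega X D1 u1) (ext_Omega X D2 u2) = 0.

Definition colorable (M : nat) (D : 'I_M -> set 'rV[R]_d) (k : nat) : Prop :=
  exists c : 'I_M -> 'I_k,
    forall i j, i != j -> c i = c j -> a_orthogonal (D i) (D j).

Definition coloring_constant (M : nat) (D : 'I_M -> set 'rV[R]_d)
    (z : nat) : Prop :=
  [/\ (0 < z)%N, colorable D z
    & forall k, (0 < k)%N -> colorable D k -> (z <= k)%N].

(* The laws of local_spaces determine form D only when one argument lies in
   V0 D: multiplying it by a constant on a complement Va D preserves all of them
   and rescales the eigenvalues, but not the method. The energies of restrictions
   to a color class therefore have to be bounded by a separate requirement. For
   a_D(u,v) = int_D (A grad u . grad v) and disjoint subdomains it is the
   additivity of the integral. *)
Definition energy_local (M : nat) (D : 'I_M -> set 'rV[R]_d) : Prop :=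
  forall J : {set 'I_M},
    (forall i j, i \in J -> j \in J -> i != j -> a_orthogonal (D i) (D j)) ->
  forall u : V X (Omega X),
    \sum_(i in J) form X (D i) (res X (Omega X) (D i) u)
                               (res X (Omega X) (D i) u)
    <= form X (Omega X) u u.

Variables (M : nat) (P : decomposition X M).

Definition Va (D : set 'rV[R]_d) : {vspace V X D} :=
  orthov (form X D) (V0 X D).

Definition kerVa (D : set 'rV[R]_d) : {vspace V X D} :=
  (Va D :&: orthov (form X D) (Va D))%VS.

Definition chi_res (i : 'I_M) : 'Hom(V X (oms P i), space0 X (om P i)) :=
  (chi P i \o res X (oms P i) (om P i))%VF.

Definition is_eigenpair (i : 'I_M) (mu : R) (phi : V X (oms P i)) : Prop :=
  forall v, v \in Va (oms P i) ->
    form X (om P i) (vsval (chi_res i phi)) (vsval (chi_res i v))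
    = mu * form X (oms P i) phi v.

(* A complete list of eigenpairs, in decreasing order of the eigenvalues and
   with multiplicity; indices start at 0. *)
Definition eigensystem (i : 'I_M) (lam : seq (\bar R))
    (phi : seq (V X (oms P i))) : Prop :=
  let l := \dim (kerVa (oms P i)) in
  [/\ size lam = size phi,
      basis_of (Va (oms P i)) phi,
      basis_of (kerVa (oms P i)) (take l phi),
      forall j, (j < size phi)%N ->
        if (j < l)%N then nth 0%E lam j = +oo%E
        else exists2 mu, nth 0%E lam j = mu%:E & is_eigenpair mu (nth 0 phi j)
    & forall j k, (j <= k < size phi)%N ->
        (nth 0%E lam k <= nth 0%E lam j)%E].

(* In both definitions that follow, m_i may exceed dim V_a(oms_i): then all
   eigenfunctions are selected, and lambda_{i,m_i+1} is taken to be 0. *)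
Definition local_coarse (phi : forall i, seq (V X (oms P i)))
    (m : 'I_M -> nat) (i : 'I_M) : {vspace V X (om P i)} :=
  <<map (res X (oms P i) (om P i)) (take (m i) (phi i))>>%VS.

(* The maximum is finite when M > 0 and m_i >= l_i for all i. *)
Definition Lambda (zeta zetas : nat) (lam : 'I_M -> seq (\bar R))
    (m : 'I_M -> nat) : R :=
  Num.sqrt (zeta%:R * zetas%:R *
            fine (\big[maxe/-oo%E]_(i < M) nth 0%E (lam i) (m i))).

Definition coarse (phi : forall i, seq (V X (oms P i))) (m : 'I_M -> nat) :
    {vspace V X (Omega X)} :=
  (\sum_(i < M) (ext_Omega X (om P i) \o chi P i) @: local_coarse phi m i)%VS.

Definition chit (i : 'I_M) : 'End(space0 X (oms P i)) :=
  (ext X (om P i) (oms P i) \o chi_res i \o incl (V0 X (oms P i)))%VF.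

End Method.

(* mxof acts on row vectors, the matrix representations here on columns. *)
Definition mxrep (R : realType) (U W : vectType R)
    (eU : (\dim {:U}).-tuple U) (eW : (\dim {:W}).-tuple W) (g : 'Hom(U, W)) :
    'M[R]_(\dim {:W}, \dim {:U}) :=
  (mxof eU eW g)^T.

Section Matrices.
Variables (R : realType) (d : nat) (X : local_spaces R d).
Variables (M : nat) (P : decomposition X M) (S : {vspace V X (Omega X)}).
Local Notation VO := (V X (Omega X)).
Local Notation n := (\dim {:VO}).
Variables (e : n.-tuple VO).
Variables (es : forall i, (\dim {:space0 X (oms P i)}).-tuple
                            (space0 X (oms P i))).
Variables (eS : (\dim {:subvs_of S}).-tuple (subvs_of S)).

Definition stiffness : 'M[R]_n :=
  \matrix_(k, l) form X (Omega X) (tnth e l) (tnth e k).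

Definition load (F : {scalar VO}) : 'cV[R]_n := \col_k F (tnth e k).

Definition R_loc (i : 'I_M) := (mxrep (es i) e (ext_Omega X (oms P i)))^T.

Definition R_S := (mxrep eS e (incl S))^T.

Definition chi_mx (i : 'I_M) := mxrep (es i) (es i) (chit P i).

Definition A_loc (i : 'I_M) := R_loc i *m stiffness *m (R_loc i)^T.

Definition A_S := R_S *m stiffness *m R_S^T.

Definition one_level : 'M[R]_n :=
  \sum_(i < M) (R_loc i)^T *m chi_mx i *m invmx (A_loc i) *m R_loc i.

Definition precond : 'M[R]_n :=
  one_level
  + (R_S^T *m invmx A_S *m R_S) *m (1%:M - stiffness *m one_level).

End Matrices.

Definition form_norm (R : realType) (n : nat) (b : {dot 'cV[R]_n for idfun})
    (v : 'cV[R]_n) : R :=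
  Num.sqrt (b v v).

Definition krylov (R : realType) (n : nat) (C : 'M[R]_n) (x : 'cV[R]_n)
    (j : nat) : {vspace 'cV[R]_n} :=
  <<[seq C ^+ k *m x | k <- iota 1 j]>>%VS.

(* With C = BA, the residual of the preconditioned system at v is C (u - v). *)
Definition gmres_iterate (R : realType) (n : nat)
    (b : {dot 'cV[R]_n for idfun}) (C : 'M[R]_n) (u u0 : 'cV[R]_n) (j : nat)
    (uj : 'cV[R]_n) : Prop :=
  uj - u0 \in krylov C (u - u0) j /\
  forall v, v - u0 \in krylov C (u - u0) j ->
    form_norm b (C *m (u - uj)) <= form_norm b (C *m (u - v)).

(* Main.v *)
Require Import Defs.
From mathcomp Require Import all_boot all_order all_algebra.
From mathcomp Require Import all_classical all_reals ereal topology normedtype.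
From mathcomp Require Import ring lra.

Import Order.TTheory GRing.Theory Num.Theory passmx.
Local Open Scope ring_scope.

(* In the energy norm the error propagation operator factors as
   I - BA = (I - Q)(I - T), where T is the one-level operator and Q the energy
   projection onto the coarse space.  On each oversampling domain the residual
   u - P_i u of the local projection lies in V_a, and removing a suitable
   combination of the first m_i eigenfunctions leaves a remainder on which the
   energy of chi_i is at most lambda_{i,m_i+1} times the energy of the
   residual.  Since Q is optimal, summing over the colors of the two coverings
   shows that I - BA contracts the energy norm by Lambda.  The residual
   polynomial (1 - t)^j is admissible for GMRES, which gives the bound even
   without the factor (1 + Lambda) / (1 - Lambda) >= 1. *)

(** * Positive semidefinite forms: colored sums and spectral truncation *)

Section SemidefiniteForms.
Variables (R : realType) (W : vectType R) (f : {symmetric W}).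
Hypothesis f_ge0 : forall u, 0 <= f u u.

Lemma symmetricC u v : f u v = f v u.
Proof. by rewrite hermC expr0 mul1r. Qed.

Lemma symmetric_mul2_le u v : 2 * f u v <= f u u + f v v.
Proof.
have := f_ge0 (u - v); rewrite linearBl !linearBr /= (symmetricC v u).
lra.
Qed.

(** Cross terms inside a color vanish, so only the k color sums [y t] interact. Bounding each of
    their k^2 products by half the sum of the two energies costs a factor k. *)
Lemma colored_sum_le (M k : nat) (c : 'I_M -> 'I_k) (x : 'I_M -> W) :
  (forall i j, i != j -> c i = c j -> f (x i) (x j) = 0) ->
  f (\sum_i x i) (\sum_i x i) <= k%:R * \sum_i f (x i) (x i).
Proof.
move=> x_orth; pose y t := \sum_(i | c i == t) x i.
have yE t : f (y t) (y t) = \sum_(i | c i == t) f (x i) (x i).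
  rewrite linear_sumlz; apply: eq_bigr => i /eqP cit.
  rewrite linear_sumr (bigD1 i) ?cit //= big1 ?addr0 // => j
    /andP[/eqP cjt nji].
  by rewrite x_orth ?cit ?cjt // eq_sym.
have -> : \sum_i x i = \sum_t y t by exact: partition_big.
have -> : \sum_i f (x i) (x i) = \sum_t f (y t) (y t).
  by rewrite (partition_big c xpredT) //=; apply: eq_bigr => t _; rewrite yE.
rewrite linear_sumlz.
under eq_bigr do rewrite linear_sumr.
rewrite -(ler_pM2l (_ : 0 < 2)) // mulr_sumr.
under eq_bigr do rewrite mulr_sumr.
apply: (@le_trans _ _ (\sum_s \sum_t (f (y s) (y s) + f (y t) (y t)))).
  by do 2!apply: ler_sum => ? _; exact: symmetric_mul2_le.
under eq_bigr do rewrite big_split /=.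
rewrite big_split /= exchange_big /= -mulr2n.
by rewrite sumr_const card_ord !mulr_natl.
Qed.

(* With z the sum of the x_j weighted by sqrt (d_j), the sum is f (z, z). *)
Lemma weighted_gram_ge0 (I : finType) (A : {pred I}) (d : I -> R) (x : I -> W) :
  {in A, forall j, 0 <= d j} ->
  {in A &, forall j k, d j != d k -> f (x j) (x k) = 0} ->
  0 <= \sum_(j in A) \sum_(k in A) d j * f (x j) (x k).
Proof.
move=> d_ge0 x_orth.
have := f_ge0 (\sum_(j in A) Num.sqrt (d j) *: x j).
rewrite linear_sumlz.
under eq_bigr do rewrite linear_sumr.
congr (_ <= _); apply: eq_bigr => j Aj; apply: eq_bigr => k Ak.
rewrite linearZl_LR linearZr_LR /= /GRing.scale /= mulrA.
have [<-|/x_orth ->] := eqVneq (d j) (d k); rewrite ?mulr0 //.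
by rewrite -expr2 sqr_sqrtr // d_ge0.
Qed.

End SemidefiniteForms.

(** Expand w in the eigenvectors and let p carry the large eigenvalues: the rest r is f-orthogonal
    to p, so its f-energy is at most that of w. As [h] may be indefinite, [lam m] may be negative;
    the maximum with 0 keeps the last comparison monotone. *)
Lemma spectral_tail_le (R : realType) (V W : vectType R) (f : {symmetric V})
    (h : {symmetric W}) (g : 'Hom(V, W)) (U : {vspace V}) (phi : seq V)
    (lam : nat -> R) (l m : nat) :
  (forall u, 0 <= f u u) -> basis_of U phi -> (l <= m)%N ->
  (forall j, (j < size phi)%N -> (j < l)%N ->
     {in U, forall v, f phi`_j v = 0}) ->
  (forall j, (j < size phi)%N -> (l <= j)%N ->
     {in U, forall v, h (g phi`_j) (g v) = lam j * f phi`_j v}) ->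
  (forall j k, (l <= j)%N -> (j <= k < size phi)%N -> lam k <= lam j) ->
  {in U, forall w, exists2 p, p \in <<take m phi>>%VS &
    h (g (w - p)) (g (w - p)) <= Num.max 0 (lam m) * f w w}.
Proof.
move=> f_ge0 phiB ker_le_m kerP eigP lamP w Uw.
(* If m reaches the end of the list, p = w leaves no remainder, whatever [lam m] is. *)
have [mge|mlt] := leqP (size phi) m.
  exists w; first by rewrite take_oversize // (span_basis phiB).
  by rewrite subrr !linear0 mulr_ge0 // le_max lexx.
pose n := size phi; pose c := coord (in_tuple phi).
pose x (j : 'I_n) := c j w *: phi`_j.
have wE : w = \sum_j x j.
  exact: (@coord_basis _ _ _ _ (in_tuple phi) _ phiB Uw).
have Uphi (j : 'I_n) : phi`_j \in U by rewrite (basis_mem phiB) ?mem_nth.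
have Ux j : x j \in U by rewrite memvZ.
(* The eigenvectors of one eigenvalue need not be orthogonal, so p keeps only the
   components whose eigenvalue exceeds lam m: those are orthogonal to the rest
   even when the multiplicity of lam m straddles the index m. *)
pose A : {pred 'I_n} := [pred j : 'I_n | (l <= j)%N && (lam j <= lam m)].
pose p := \sum_(j | j \notin A) x j; pose r := \sum_(j in A) x j.
have wpr : w = r + p by rewrite wE (bigID (mem A)).
have Ur : r \in U by apply: memv_suml.
have eigx j v : j \in A -> v \in U -> h (g (x j)) (g v) = lam j * f (x j) v.
  case/andP=> lj _ Uv; rewrite linearZ /= !linearZl_LR /= eigP //.
  by rewrite /GRing.scale /= mulrCA.
have eigC (j k : 'I_n) : (l <= j)%N -> (l <= k)%N -> lam j != lam k ->
    f (phi`_j) (phi`_k) = 0.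
  move=> lj lk; apply: contraNeq => fn0; apply/eqP/(mulIf fn0).
  by rewrite -eigP // symmetricC eigP // symmetricC.
have fxE j k : f (x j) (x k) = c j w * (c k w * f phi`_j phi`_k).
  by rewrite linearZl_LR linearZr_LR.
(* A component of p lies either in the kernel of f or at an eigenvalue strictly above [lam m], hence
   different from all those in r. *)
have fpr : f r p = 0.
  rewrite symmetricC linear_sumlz big1 // => j nAj.
  rewrite linear_sumr big1 // => k /andP[lk lamk].
  apply: (etrans (fxE j k)).
  have [lj|lj] := leqP l j; last by rewrite kerP // !mulr0.
  rewrite eigC ?mulr0 //; move: nAj; rewrite inE lj /= -ltNge => lamj.
  by rewrite gt_eqF // (le_lt_trans lamk).
exists p.
  apply: memv_suml => j nAj; rewrite memvZ // memv_span //.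
  have jm : (j < m)%N.
    rewrite ltnNge; apply: contra nAj => mj; apply/andP; split.
      exact: leq_trans mj.
    by rewrite lamP // mj /=.
  rewrite -(nth_take _ jm) mem_nth // size_take mlt.
  exact: jm.
have -> : w - p = r by rewrite wpr addrK.
apply: (@le_trans _ _ (lam m * f r r)).
  (* The gap between the two sides is a Gram sum with weights [lam m - lam j], nonnegative on A;
     different weights mean different eigenvalues, hence orthogonal vectors. *)
  have := @weighted_gram_ge0 _ _ f f_ge0 _ A (fun j => lam m - lam j) x.
  have -> : \sum_(j in A) \sum_(k in A) (lam m - lam j) * f (x j) (x k)
      = lam m * f r r - h (g r) (g r).
    have hE : h (g r) (g r) = \sum_(j in A) lam j * f (x j) r.
      have {1}-> : g r = \sum_(j in A) g (x j) by exact: linear_sum.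
      rewrite linear_sumlz; by apply: eq_bigr => j Aj; exact: eigx.
    have -> : f r r = \sum_(j in A) f (x j) r by exact: linear_sumlz.
    rewrite hE mulr_sumr -sumrB; apply: eq_bigr => j _.
    by rewrite -mulr_sumr -mulrBl; congr (_ * _); rewrite linear_sumr.
  rewrite subr_ge0; apply.
    by move=> j /andP[_ ?]; rewrite subr_ge0.
  move=> j k /andP[lj _] /andP[lk _] jk.
  rewrite fxE eigC ?mulr0 //.
  by apply: contraNN jk => /eqP ->.
apply: (@le_trans _ _ (Num.max 0 (lam m) * f r r)).
  by rewrite ler_wpM2r // le_max lexx orbT.
rewrite ler_wpM2l ?le_max ?lexx // wpr hnormDd //.
by rewrite lerDl.
Qed.

(** * Coordinates: Krylov residuals and Galerkin solves *)

Section Matrices.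
Variable R : realType.

Lemma injective_mx_unit (n : nat) (A : 'M[R]_n) :
  (forall x : 'cV_n, A *m x = 0 -> x = 0) -> A \in unitmx.
Proof.
move=> A_inj; rewrite -unitmx_tr -row_free_unit -kermx_eq0.
apply/rowV0P => v /sub_kermxP /(congr1 trmx).
rewrite trmx_mul trmxK trmx0 => /A_inj /(congr1 trmx).
by rewrite trmxK trmx0.
Qed.

Lemma vecof_mxrep (U W : vectType R) (eU : (\dim {:U}).-tuple U)
    (eW : (\dim {:W}).-tuple W) (g : 'Hom(U, W)) (x : 'cV_(\dim {:U})) :
  basis_of fullv eW -> vecof eW (mxrep eU eW g *m x)^T = g (vecof eU x^T).
Proof. by move=> eWB; rewrite trmx_mul trmxK -hom_vecof. Qed.

(** In the binomial expansion of (1 - C)^j the constant term cancels x, leaving only the powers 1 to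
    j of C. *)
Lemma krylov_residual (n : nat) (C : 'M[R]_n) (x : 'cV[R]_n) (j : nat) :
  x - (1%:M - C) ^+ j *m x \in krylov C x j.
Proof.
have /exprDn_comm -> : GRing.comm (1%:M : 'M[R]_n) (- C).
  exact/commr_sym/commr1.
rewrite big_ord_recl /= bin0 expr0 mulr1 mulr1n expr1n mulmxDl mul1mx.
rewrite opprD addNKr memvN mulmx_suml; apply: memv_suml => i _.
rewrite expr1n mul1r exprNn -signr_odd mulr_sign -scaler_nat -scalemxAl.
apply: memvZ.
suff ? : C ^+ lift ord0 i *m x \in krylov C x j.
  by case: ifP; rewrite ?mulNmx ?memvN.
by apply/memv_span/map_f; rewrite mem_iota lift0 /= ltnS ltn_ord.
Qed.

Variables (W : vectType R) (a : {symmetric W}).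
Hypothesis a_gt0 : forall u, u != 0 -> 0 < a u u.
Variables (e : (\dim {:W}).-tuple W) (K : 'M[R]_(\dim {:W})).
Hypothesis eB : basis_of fullv e.
Hypothesis KE : forall x y : 'cV_(\dim {:W}),
  a (vecof e x^T) (vecof e y^T) = (x^T *m K *m y) 0 0.

(** Serves both the local solves and the coarse solve: [y] holds the coordinates of the energy
    projection of x onto the image of G. *)
Lemma galerkin_solve (U : vectType R) (eU : (\dim {:U}).-tuple U)
    (G : 'Hom(U, W)) (x : 'cV_(\dim {:W})) :
  let Q := (mxrep eU e G)^T in
  let y := invmx (Q *m K *m Q^T) *m Q *m K *m x in
  basis_of fullv eU -> (forall v, G v = 0 -> v = 0) ->
  forall v, a (G v) (G (vecof eU y^T)) = a (G v) (vecof e x^T).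
Proof.
move=> Q y eUB G_inj v.
have QT z : vecof e (Q^T *m z)^T = G (vecof eU z^T).
  by rewrite trmxK vecof_mxrep.
(* A vector in the kernel represents an element whose image under G has zero energy; definiteness of
   [a] and injectivity of G make it 0. *)
have Aunit : Q *m K *m Q^T \in unitmx.
  apply: injective_mx_unit => z /(congr1 (mulmx z^T)).
  rewrite mulmx0 => Az0.
  have : a (G (vecof eU z^T)) (G (vecof eU z^T)) = 0.
    by rewrite -QT KE trmx_mul trmxK !mulmxA in Az0 *; rewrite Az0 mxE.
  have [/G_inj/eqP|/a_gt0/gt_eqF/eqP//] := eqVneq (G (vecof eU z^T)) 0.
  by rewrite vecof_eq0 // => /eqP z0 _; rewrite -[z]trmxK z0 trmx0.
rewrite -(rVofK eUB v) -[rVof eU v]trmxK -!QT !KE trmx_mul trmxK.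
congr ((_ : 'M_1) 0 0); rewrite -!mulmxA; congr (_ *m _).
by rewrite trmxK /y !mulmxA mulmxV // mul1mx.
Qed.
End Matrices.

Lemma stiffnessE (R : realType) (d : nat) (X : local_spaces R d)
    (e : (\dim {:V X (Omega X)}).-tuple (V X (Omega X)))
    (x y : 'cV[R]_(\dim {:V X (Omega X)})) :
  Defs.form X (Omega X) (vecof e x^T) (vecof e y^T)
  = (x^T *m stiffness e *m y) 0 0.
Proof.
rewrite /vecof linear_sumlz -mulmxA mxE; apply: eq_bigr => k _.
rewrite linearZl_LR linear_sumr !mxE /=; congr (_ * _); apply: eq_bigr => l _.
rewrite linearZr_LR !mxE /= mulrC -!tnth_nth. congr (_ * _).
by rewrite symmetricC.
Qed.

(** * Zero extension, restriction and local energies *)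

Section LocalSpaces.
Variables (R : realType) (d : nat) (X : local_spaces R d).
Local Notation a := (Defs.form X (Omega X)).
Local Notation rs := (Defs.res X (Omega X)).

Lemma form_Omega_ge0 u : 0 <= a u u.
Proof. exact/form_ge0/subdomain_Omega. Qed.

Lemma res_ext_Omega D (v : space0 X D) :
  subdomain X D -> rs D (ext_Omega X D v) = vsval v.
Proof.
move=> sD; rewrite comp_lfunE /incl lfunE /=.
by rewrite res_ext //; [exact: subdomain_Omega|exact: subdomain_sub].
Qed.

Lemma form_ext_Omega D u (v : space0 X D) : subdomain X D ->
  a u (ext_Omega X D v) = Defs.form X D (rs D u) (vsval v).
Proof.
move=> sD; rewrite comp_lfunE /incl lfunE /= form_res_ext //.
  exact: subdomain_Omega.
exact: subdomain_sub.
Qed.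

Lemma ext_Omega_isometry D (u v : space0 X D) : subdomain X D ->
  a (ext_Omega X D u) (ext_Omega X D v) = Defs.form X D (vsval u) (vsval v).
Proof. by move=> sD; rewrite form_ext_Omega // res_ext_Omega. Qed.

Lemma ext_Omega_inj D (v : space0 X D) :
  subdomain X D -> ext_Omega X D v = 0 -> v = 0.
Proof.
move=> sD v0; apply: val_inj; rewrite /= -[LHS]res_ext_Omega //.
by rewrite v0 !linear0.
Qed.

(* Transitivity of the zero extensions is not among the laws: it follows from
   that of the restrictions by duality with respect to the form. *)
Lemma ext_Omega_ext D Ds (v : space0 X D) :
  subdomain X D -> subdomain X Ds -> (D `<=` Ds)%classic ->
  ext_Omega X Ds (ext X D Ds v) = ext_Omega X D v.
Proof.
move=> sD sDs DDs; apply/eqP; rewrite -subr_eq0; apply: contraT.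
set w := _ - _ => /form_gt0; rewrite {2}/w linearBr /=.
rewrite !form_ext_Omega // -form_res_ext // res_comp ?subrr ?ltxx //.
  exact: subdomain_Omega.
exact: subdomain_sub.
Qed.

Lemma energy_color_sum_le (M k : nat) (D : 'I_M -> set 'rV[R]_d) u :
  energy_local X D -> colorable X D k ->
  \sum_i Defs.form X (D i) (rs (D i) u) (rs (D i) u) <= k%:R * a u u.
Proof.
move=> locD [c cD]; rewrite (partition_big c xpredT) //=.
rewrite mulr_natl -[k in leRHS]card_ord -sumr_const; apply: ler_sum => t _.
rewrite (eq_bigl (mem [set i | c i == t])) => [|i]; last by rewrite !inE.
apply: locD => i j; rewrite !inE => /eqP ci /eqP cj ij.
by apply: cD; rewrite ?ci.
Qed.

(** The duality of extension and restriction moves the Galerkin equation from Omega to D, where w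
    becomes orthogonal to [V0 X D]; Pythagoras then bounds its energy. *)
Lemma local_residual D u (z : space0 X D) (w := rs D u - vsval z) :
  subdomain X D ->
  (forall v, a (ext_Omega X D v) (ext_Omega X D z) = a (ext_Omega X D v) u) ->
  w \in Va X D /\
  Defs.form X D w w <= Defs.form X D (rs D u) (rs D u).
Proof.
move=> sD zP.
have wP (v : space0 X D) : Defs.form X D w (vsval v) = 0.
  rewrite linearBl /= -ext_Omega_isometry // -form_ext_Omega //.
  by rewrite symmetricC -zP symmetricC subrr.
split.
  apply/mem_orthovP => v Dv; have := wP (Subvs Dv); rewrite /=.
  exact.
have -> : rs D u = w + vsval z by rewrite subrK.
by rewrite [leRHS]hnormDd ?wP // lerDl form_ge0.
Qed.

(** * Local spectral approximation and the two-level estimate *)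

Section Decomposition.
Variables (M : nat) (P : decomposition X M) (lam : 'I_M -> seq (\bar R)).
Variables (phi : forall i, seq (V X (oms P i))) (m : 'I_M -> nat).
Hypothesis lam_phi : forall i, eigensystem (lam i) (phi i).
Hypothesis ker_le_m : forall i, (\dim (kerVa X (oms P i)) <= m i)%N.

Lemma local_approx i w : w \in Va X (oms P i) ->
  exists2 p, Defs.res X (oms P i) (om P i) p \in local_coarse phi m i &
  Defs.form X (om P i) (vsval (chi_res P i (w - p)))
                       (vsval (chi_res P i (w - p)))
  <= Num.max 0 (fine (nth 0%E (lam i) (m i))) * Defs.form X (oms P i) w w.
Proof.
move=> wV; have [szE phiB kerB eigP lamP] := lam_phi i.
pose g := (Defs.incl (V0 X (om P i)) \o chi_res P i)%VF.
have gE v : g v = vsval (chi_res P i v) by rewrite comp_lfunE /incl lfunE.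
have kerVaP j : (j < size (phi i))%N -> (j < \dim (kerVa X (oms P i)))%N ->
    {in Va X (oms P i), forall v, Defs.form X (oms P i) (phi i)`_j v = 0}.
  move=> jphi jl; have : (phi i)`_j \in kerVa X (oms P i).
    rewrite -(nth_take _ jl) (basis_mem kerB) // mem_nth //.
    by rewrite size_take; case: ifP.
  by rewrite memv_cap => /andP[_ /mem_orthovP].
have lamE j : (j < size (phi i))%N -> (\dim (kerVa X (oms P i)) <= j)%N ->
    exists2 mu, nth 0%E (lam i) j = mu%:E & is_eigenpair mu (phi i)`_j.
  by move=> jphi jl; have := eigP j jphi; rewrite ltnNge jl.
have [j jphi jl v vV|j k jl /andP[jk kphi]|p pm] := @spectral_tail_le R _ _ _
    (Defs.form X (om P i)) g _ _ (fun j => fine (nth 0%E (lam i) j)) _ _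
    (form_ge0 (oms_subdomain P i)) phiB (ker_le_m i) kerVaP _ _ w wV.
- by have [mu -> /(_ v vV)] := lamE j jphi jl; rewrite !gE.
- have := lamP j k; rewrite jk kphi => /(_ isT).
  have [mu -> _] := lamE j (leq_ltn_trans jk kphi) jl.
  by have [nu -> _] := lamE k kphi (leq_trans jl jk); rewrite lee_fin.
rewrite !gE => ple; exists p => //.
by rewrite /local_coarse -limg_span memv_img.
Qed.

(** A nonpositive eigenvalue makes the left side 0; a positive one makes the maximum positive, so
    that squaring undoes the square root in [Lambda]. *)
Lemma sqr_Lambda_ge (zeta zetas : nat) i :
  zeta%:R * zetas%:R * Num.max 0 (fine (nth 0%E (lam i) (m i)))
  <= Lambda zeta zetas lam m ^+ 2.
Proof.
(* Past the end of the list the default 0 is read; before it, [ker_le_m] excludes the infinite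
   eigenvalues. *)
have lam_fin k : nth 0%E (lam k) (m k) \is a fin_num.
  have [szE _ _ eigP _] := lam_phi k.
  have [mphi|phim] := ltnP (m k) (size (phi k)).
    by have := eigP _ mphi; rewrite ltnNge ker_le_m /= => -[mu ->].
  by rewrite nth_default ?szE.
have [lam0|lam0] := leP (fine (nth 0%E (lam i) (m i))) 0.
  by rewrite mulr0 sqr_ge0.
set L := (\big[maxe/-oo%E]_(k < M) nth 0%E (lam k) (m k))%E.
have lamL : (nth 0%E (lam i) (m i) <= L)%E by exact: le_bigmax.
have L_fin : L \is a fin_num.
  rewrite fin_real // (lt_le_trans _ lamL) ?ltNye_eq ?lam_fin //=.
  apply/bigmax_ltP; split=> // k _.
  by rewrite ltey_eq lam_fin.
have lamfL : fine (nth 0%E (lam i) (m i)) <= fine L by apply: fine_le.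
rewrite sqr_sqrtr ?ler_wpM2l ?mulr_ge0 ?ler0n //.
exact/ltW/(lt_le_trans lam0).
Qed.

(** The partition of unity writes r as a sum of chi_i applied to the local residuals, and s collects
    the local approximants of these. The coloring of [om] controls the energy of the sum [r - s],
    that of [oms] the total energy of the restrictions of u. *)
Lemma two_level_approx (zeta zetas : nat) u
    (z : forall i, space0 X (oms P i)) :
  (0 < M)%N -> colorable X (om P) zeta -> colorable X (oms P) zetas ->
  energy_local X (oms P) ->
  (forall i v, a (ext_Omega X (oms P i) v) (ext_Omega X (oms P i) (z i))
             = a (ext_Omega X (oms P i) v) u) ->
  let r := u - \sum_i ext_Omega X (oms P i) (chit P i (z i)) in
  exists2 s, s \in coarse phi m &
    a (r - s) (r - s) <= Lambda zeta zetas lam m ^+ 2 * a u u.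
Proof.
move=> M_gt0 c_om c_oms locP zP r.
pose w i := rs (oms P i) u - vsval (z i).
have wP i := @local_residual (oms P i) u (z i) (oms_subdomain P i) (zP i).
have /fin_all_exists2 [p pS ple] := fun i =>
   @local_approx i (w i) (proj1 (wP i)).
exists (\sum_i ext_Omega X (om P i)
          (chi P i (Defs.res X (oms P i) (om P i) (p i)))).
  apply: memv_sumr => i _.
  have := memv_img (ext_Omega X (om P i) \o chi P i) (pS i).
  by rewrite comp_lfunE.
pose x i := ext_Omega X (om P i) (chi_res P i (w i - p i)).
have -> : r - \sum_i ext_Omega X (om P i)
    (chi P i (Defs.res X (oms P i) (om P i) (p i))) = \sum_i x i.
  rewrite /r {1}(chi_unity P u) -!sumrB; apply: eq_bigr => i _.
  rewrite /x /w !linearB /=; congr (_ - _ - _).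
  - rewrite [chi_res _ _ _]comp_lfunE res_comp //; do ?exact: om_subdomain.
    + exact: oms_subdomain.
    + exact: subdomain_Omega.
    + exact: om_sub_oms.
    + exact/subdomain_sub/oms_subdomain.
  - rewrite [chit _ _ _]comp_lfunE [X in ext_Omega _ _ X]comp_lfunE.
    rewrite ext_Omega_ext /Defs.incl ?lfunE //.
    + exact: om_subdomain.
    + exact: oms_subdomain.
    + exact: om_sub_oms.
  - by rewrite [chi_res _ _ _]comp_lfunE.
have [c cP] := c_om.
apply: le_trans (@colored_sum_le _ _ a form_Omega_ge0 _ _ c x _) _.
  by move=> i j ij cij; apply: cP.
pose L := Lambda zeta zetas lam m ^+ 2.
pose n i := Defs.form X (oms P i) (rs (oms P i) u) (rs (oms P i) u).
have zetas_gt0 : (0 < zetas)%N.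
  have [c' _] := c_oms.
  exact: leq_ltn_trans (leq0n _) (ltn_ord (c' (Ordinal M_gt0))).
have zetasR : 0 < zetas%:R :> R by rewrite ltr0n.
(* The factor [zetas] is put on both sides so that [sqr_Lambda_ge] applies term by term; the
   coloring of [oms] gives it back on the right. *)
rewrite -(ler_pM2l zetasR) mulr_sumr mulr_sumr.
apply: (@le_trans _ _ (\sum_i L * n i)).
  apply: ler_sum => i _; rewrite mulrA [zetas%:R * _]mulrC.
  rewrite ext_Omega_isometry; last exact: om_subdomain.
  apply: (@le_trans _ _ (zeta%:R * zetas%:R *
    (Num.max 0 (fine (nth 0%E (lam i) (m i))) * n i))).
    rewrite ler_wpM2l ?mulr_ge0 ?ler0n // (le_trans (ple i)) //.
    by rewrite ler_wpM2l ?le_max ?lexx // (proj2 (wP i)).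
  rewrite mulrA ler_wpM2r ?sqr_Lambda_ge //.
  exact/form_ge0/oms_subdomain.
rewrite -mulr_sumr [leRHS]mulrCA ler_wpM2l ?sqr_ge0 //.
exact: energy_color_sum_le.
Qed.
End Decomposition.
End LocalSpaces.

(** * Contraction of the error in the energy norm *)

Section Contraction.
Variables (R : realType) (d : nat) (X : local_spaces R d).
Variables (M : nat) (M_gt0 : (0 < M)%N) (P : decomposition X M).
Variables (zeta zetas : nat).
Hypothesis c_om : colorable X (om P) zeta.
Hypothesis c_oms : colorable X (oms P) zetas.
Hypothesis locP : energy_local X (oms P).
Variables (lam : 'I_M -> seq (\bar R)) (phi : forall i, seq (V X (oms P i))).
Variable (m : 'I_M -> nat).
Hypothesis lam_phi : forall i, eigensystem (lam i) (phi i).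
Hypothesis ker_le_m : forall i, (\dim (kerVa X (oms P i)) <= m i)%N.
Local Notation VO := (V X (Omega X)).
Local Notation n := (\dim {:VO}).
Local Notation a := (Defs.form X (Omega X)).
Variables (e : n.-tuple VO).
Hypothesis eB : basis_of fullv e.
Variables (es : forall i, (\dim {:space0 X (oms P i)}).-tuple
                            (space0 X (oms P i))).
Hypothesis esB : forall i, basis_of fullv (es i).
Variable eS : (\dim {:subvs_of (coarse phi m)}).-tuple
                (subvs_of (coarse phi m)).
Hypothesis eSB : basis_of fullv eS.
Local Notation A := (stiffness e).
Local Notation C := (precond e es eS *m A).
Local Notation vec x := (vecof e x^T).

Lemma energy_contraction (x : 'cV_n) :
  a (vec ((1%:M - C) *m x)) (vec ((1%:M - C) *m x))
  <= Lambda zeta zetas lam m ^+ 2 * a (vec x) (vec x).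
Proof.
pose Q i := R_loc e es i.
pose y i := invmx (A_loc e es i) *m Q i *m A *m x.
pose z i := vecof (es i) (y i)^T.
pose t := one_level e es *m A *m x.
have tE : vec t = \sum_i ext_Omega X (oms P i) (chit P i (z i)).
  rewrite /t /one_level !mulmx_suml !linear_sum; apply: eq_bigr => i _.
  rewrite -!mulmxA [(R_loc _ _ _)^T]trmxK /= vecof_mxrep // vecof_mxrep ?esB //.
  by rewrite /z /y !mulmxA.
have zP k v : a (ext_Omega X (oms P k) v) (ext_Omega X (oms P k) (z k))
              = a (ext_Omega X (oms P k) v) (vec x).
  apply: galerkin_solve => //; first exact: form_gt0.
    exact: stiffnessE.
  move=> v0; apply/ext_Omega_inj/oms_subdomain.
have [s sS sle] :=
  two_level_approx _ _ _ _ _ _ _ _ lam_phi ker_le_m _ _ _ _ M_gt0 c_om c_oms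
    locP zP.
(* The coarse correction acts on what the one-level step leaves, so [zS] is the projection Q of
   [x - t]. *)
pose q := R_S e eS; pose yS := invmx (A_S e eS) *m q *m A *m (x - t).
pose zS := Defs.incl (coarse phi m) (vecof eS yS^T).
have zSP v : v \in coarse phi m -> a v zS = a v (vec (x - t)).
  move=> vS; have {1 2}-> : v = Defs.incl _ (Subvs vS) by rewrite lfunE.
  apply: galerkin_solve => //; first exact: form_gt0.
    exact: stiffnessE.
  by move=> w; rewrite lfunE /= => w0; apply: val_inj.
have CE : vec ((1%:M - C) *m x) = vec (x - t) - zS.
  rewrite /zS -(vecof_mxrep _ _ _ eS e) // -linearB -linearB /=.
  congr (vecof e _^T).
  rewrite -[mxrep _ _ _]trmxK -/(R_S e eS) -/q /yS /t /precond.
  rewrite mulmxBl mul1mx 2!mulmxDl opprD addrA; congr (_ - _).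
  by rewrite /q !(mulmxA, mulmxBr, mulmxBl, mulmx1).
rewrite CE; apply: le_trans sle; rewrite -tE -linearB -linearB /=.
(* Optimality of Q by Pythagoras: the first bracket is orthogonal to the coarse space, which
   contains the second. *)
have -> : vec (x - t) - s = (vec (x - t) - zS) + (zS - s).
  by rewrite addrA subrK.
rewrite [leRHS]hnormDd ?lerDl ?form_Omega_ge0 //.
rewrite linearBl /= symmetricC [X in _ - X]symmetricC zSP ?subrr //.
by rewrite memvB // /zS lfunE /= subvsP.
Qed.
End Contraction.

(** * The GMRES residual bound *)

Theorem theorem4p11 (R : realType) (d : nat) (X : local_spaces R d)
  (F : {scalar V X (Omega X)})
  (M : nat) (hM : (0 < M)%N) (P : decomposition X M)
  (zeta zetas : nat)
  (hzeta : coloring_constant X (om P) zeta)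
  (hzetas : coloring_constant X (oms P) zetas)
  (hlocal : energy_local X (oms P))
  (lam : 'I_M -> seq (\bar R)) (phi : forall i : 'I_M, seq (V X (oms P i)))
  (heig : forall i : 'I_M, eigensystem (lam i) (phi i))
  (m : 'I_M -> nat)
  (hm : forall i : 'I_M, (\dim (kerVa X (oms P i)) <= m i)%N)
  (e : (\dim {:V X (Omega X)}).-tuple (V X (Omega X)))
  (he : basis_of fullv e)
  (es : forall i : 'I_M,
     (\dim {:space0 X (oms P i)}).-tuple (space0 X (oms P i)))
  (hes : forall i : 'I_M, basis_of fullv (es i))
  (eS : (\dim {:subvs_of (coarse phi m)}).-tuple (subvs_of (coarse phi m)))
  (heS : basis_of fullv eS)
  (b : {dot 'cV[R]_(\dim {:V X (Omega X)}) for idfun})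
  (b1 b2 : R) (hb1 : 0 < b1) (hb2 : 0 < b2)
  (hb : forall v : 'cV[R]_(\dim {:V X (Omega X)}),
     b1 * form_norm b v <= Num.sqrt ((v^T *m stiffness e *m v) 0 0)
       <= b2 * form_norm b v)
  (u : 'cV[R]_(\dim {:V X (Omega X)})) (hu : stiffness e *m u = load e F)
  (uj : nat -> 'cV[R]_(\dim {:V X (Omega X)}))
  (huj : forall j : nat,
     gmres_iterate b (precond e es eS *m stiffness e) u (uj 0%N) j (uj j))
  (hLambda : Lambda zeta zetas lam m < 1) (j : nat) :
  form_norm b (precond e es eS *m stiffness e *m (u - uj j))
  <= Lambda zeta zetas lam m ^+ j
     * ((1 + Lambda zeta zetas lam m) / (1 - Lambda zeta zetas lam m)
        * (b2 / b1))
     * form_norm b (precond e es eS *m stiffness e *m (u - uj 0%N)).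
Proof.
set C := precond e es eS *m stiffness e; set L := Lambda zeta zetas lam m.
have L_ge0 : 0 <= L by exact: sqrtr_ge0.
pose energy (x : 'cV_(\dim {:V X (Omega X)})) :=
  Num.sqrt ((x^T *m stiffness e *m x) 0 0).
have energy_pow k x : energy ((1%:M - C) ^+ k *m x) <= L ^+ k * energy x.
  elim: k => [|k IHk] in x *; first by rewrite !expr0 mul1mx mul1r.
  rewrite exprSr -mulmxA (le_trans (IHk _)) // exprSr -mulrA.
  rewrite ler_wpM2l ?exprn_ge0 // -[X in X * _]ger0_norm // -sqrtr_sqr.
  rewrite -sqrtrM ?sqr_ge0 // ler_wsqrtr // -!stiffnessE.
  by apply: energy_contraction => //; [case: hzeta|case: hzetas].
set r0 := u - uj 0%N.
(* Commuting lets the contraction act on the initial preconditioned residual [C *m r0]. *)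
have commC : C *m (1%:M - C) ^+ j = (1%:M - C) ^+ j *m C.
  by apply/commrX/commrB; [exact: commr1|].
(* The competitor is the j-th iterate of the stationary iteration with error operator 1 - C. *)
have [_ /(_ (u - (1%:M - C) ^+ j *m r0))] := huj j.
rewrite addrAC opprB [u + (_ - u)]addrC subrK.
move=> /(_ (krylov_residual _ _ _ _ _)).
rewrite [C *m ((1%:M - C) ^+ j *m r0)]mulmxA commC -[_ *m C *m r0]mulmxA.
move=> /le_trans; apply.
have [lb _] := andP (hb ((1%:M - C) ^+ j *m (C *m r0))).
have [_ ub] := andP (hb (C *m r0)).
(* Passing from the b-norm to the energy norm costs 1 / b1, and returning costs b2. *)
apply: (@le_trans _ _ (L ^+ j * (b2 / b1) * form_norm b (C *m r0))).
  rewrite -(ler_pM2l hb1) (le_trans lb) // (le_trans (energy_pow _ _)) //.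
  rewrite [leRHS](_ : _ = L ^+ j * (b2 * form_norm b (C *m r0))).
    by rewrite ler_wpM2l ?exprn_ge0.
  by field; rewrite gt_eqF.
rewrite ler_wpM2r ?sqrtr_ge0 // ler_wpM2l ?exprn_ge0 //.
apply: ler_peMl; first by rewrite divr_ge0 ?ltW.
by rewrite ler_pdivlMr ?subr_gt0 // mul1r lerD2l ge0_cp.
Qed.
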